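(* Let $n\ge1$ and let $\mathcal{K}\subset\mathbb{R}^n$ be a closed convex centrally symmetric body with positive measure, with polar body $\mathcal{K}^o$. Suppose a closed convex centrally symmetric body $\mathcal{S}\subset\mathbb{R}^n$ has the property that every set $\Lambda\subset\mathbb{R}^n$ satisfying $\Lambda+\mathcal{S}=\mathbb{R}^n$ is a sampling set for $B_{\mathcal{K}}$. Then $\mathcal{S}\subset\rho\,\mathcal{K}^o$ for some $\rho$ with $0\le\rho<\pi/2$.
   Context: A ''closed convex centrally symmetric body'' is a compact convex set $A\subset\mathbb{R}^n$ with nonempty interior and $A=-A$. The polar body of $\mathcal{K}$ is $\mathcal{K}^o:=\{x\in\mathbb{R}^n: x\cdot t\le 1\text{ for all }t\in\mathcal{K}\}$. For sets, $A+B=\{a+b: a\in A,\ b\in B\}$ and $\rho A=\{\rho a: a\in A\}$. For a compact set $\mathcal{K}\subset\mathbb{R}^n$, the Bernstein space $B_{\mathcal{K}}$ consists of all bounded continuous functions $f:\mathbb{R}^n\to\mathbb{C}$ whose spectrum belongs to $\mathcal{K}$, meaning that $\int_{\mathbb{R}^n}f(x)\hat\varphi(x)\,dx=0$ for every smooth function $\varphi$ whose support belongs to a ball disjoint from $\mathcal{K}$, where $\hat\varphi(x)=\int_{\mathbb{R}^n}e^{-it\cdot x}\varphi(t)\,dt$. A set $\Lambda\subset\mathbb{R}^n$ is a sampling set for $B_{\mathcal{K}}$ if there is a constant $C>0$ such that $\sup_{x\in\mathbb{R}^n}|f(x)|\le C\sup_{\lambda\in\Lambda}|f(\lambda)|$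 for every $f\in B_{\mathcal{K}}$. *)

(* Defs.v *)
From HB Require Import structures.
From mathcomp Require Import all_boot all_order all_algebra.
From mathcomp Require Import all_classical all_reals all_analysis.
From mathcomp Require Import complex.

Set Implicit Arguments.
Unset Strict Implicit.
Unset Printing Implicit Defensive.

Import Order.TTheory GRing.Theory Num.Theory numFieldNormedType.Exports.

Local Open Scope classical_set_scope.
Local Open Scope ring_scope.

(** R^n is ['rV[R]_n] for topology and linear algebra; measure theory takes
    place on [n.-tuple (measurableTypeR R)], which
    carries the product sigma-algebra, and is transported by [row_of_tuple]. *)

Section lebesgue_tuple.
Context {R : realType}.
Local Notation mR := (measurableTypeR R).

Definition cons_pair (n : nat) (p : mR * n.-tuple mR) : n.+1.-tuple mR :=
  [tuple of p.1 :: p.2].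

Lemma measurable_cons_pair n : measurable_fun setT (@cons_pair n).
Proof. exact: measurable_cons. Qed.

Lemma measurable_preimage_cons_pair n (A : set (n.+1.-tuple mR)) :
  measurable A -> measurable (@cons_pair n @^-1` A).
Proof. by move=> mA; rewrite -[_ @^-1` _]setTI; exact: measurable_cons_pair. Qed.

Section lebesgue_cons.
Variables (n : nat) (m : {sigma_finite_measure set (n.-tuple mR) -> \bar R}).
Local Open Scope ereal_scope.

Definition lebesgue_cons : set (n.+1.-tuple mR) -> \bar R :=
  pushforward (@lebesgue_measure R \x m) (@cons_pair n).

Let lebesgue_cons0 : lebesgue_cons set0 = 0.
Proof. by rewrite /lebesgue_cons /pushforward preimage_set0 measure0. Qed.

Let lebesgue_cons_ge0 A : 0 <= lebesgue_cons A.
Proof. by rewrite /lebesgue_cons /pushforward measure_ge0. Qed.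

Let lebesgue_cons_sigma_additive : semi_sigma_additive lebesgue_cons.
Proof.
move=> F mF tF mUF; rewrite /lebesgue_cons /pushforward preimage_bigcup.
apply: measure_semi_sigma_additive.
- by move=> k; exact: measurable_preimage_cons_pair.
- apply/trivIsetP => /= i j _ _ ij; rewrite -preimage_setI.
  by move/trivIsetP : tF => /(_ _ _ _ _ ij) ->//; rewrite preimage_set0.
- by rewrite -preimage_bigcup; exact: measurable_preimage_cons_pair.
Qed.

HB.instance Definition _ := isMeasure.Build _ _ _
  lebesgue_cons lebesgue_cons0 lebesgue_cons_ge0 lebesgue_cons_sigma_additive.

Let lebesgue_cons_sigma_finite : sigma_finite setT lebesgue_cons.
Proof.
have [F TF Foo] := sigma_finiteT (@lebesgue_measure R).
have [G TG Goo] := sigma_finiteT m.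
pose H (q : nat * nat) : set (n.+1.-tuple mR) :=
  [set t | F q.1 (thead t) /\ G q.2 [tuple of behead t]].
have consH q : @cons_pair n @^-1` H q = F q.1 `*` G q.2.
  apply/seteqP; split=> -[x t] /=; rewrite /H /= theadE.
    by move=> [? Gt]; split=> //; rewrite (_ : t = [tuple of behead (x :: t)])//;
       apply/val_inj.
  by move=> [? Gt]; split=> //=; rewrite (_ : [tuple of _] = t)//; apply/val_inj.
have mH q : measurable (H q).
  have -> : H q = (fun t : n.+1.-tuple mR => tnth t ord0) @^-1` F q.1 `&`
      (fun t : n.+1.-tuple mR => [tuple of behead t]) @^-1` G q.2 by [].
  apply: measurableI.
    by rewrite -[_ @^-1` _]setTI; apply: measurable_tnth => //;
       have [] := Foo q.1.
  by rewrite -[_ @^-1` _]setTI; apply: measurable_behead => //;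
     have [] := Goo q.2.
exists (fun k => if unpickle k is Some q then H q else set0).
  apply/seteqP; split=> // t _.
  have : setT (thead t) by [].
  rewrite TF => -[i _ Fi].
  have : setT ([tuple of behead t] : n.-tuple mR) by [].
  rewrite TG => -[j _ Gj].
  by exists (pickle (i, j)) => //; rewrite pickleK.
move=> k; case: unpickle => [q|].
  split; first exact: mH.
  rewrite /lebesgue_cons /pushforward consH product_measure1E//; last 2 first.
    by have [] := Foo q.1.
    by have [] := Goo q.2.
  by rewrite lte_mul_pinfty// ?ge0_fin_numE//; have [] := Foo q.1;
     have [] := Goo q.2.
by split=> //; rewrite measure0.
Qed.

HB.instance Definition _ := Measure_isSigmaFinite.Build _ _ _
  lebesgue_cons lebesgue_cons_sigma_finite.

End lebesgue_cons.

(** n-dimensional Lebesgue measure: the n-fold product of [lebesgue_measure]. *)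
Fixpoint lebesgue_tuple (n : nat) :
    {sigma_finite_measure set (n.-tuple mR) -> \bar R} :=
  match n with
  | 0%N => [the {sigma_finite_measure set (0.-tuple mR) -> \bar R} of
            dirac ([tuple] : 0.-tuple mR)]
  | n'.+1 => [the {sigma_finite_measure set (n'.+1.-tuple mR) -> \bar R} of
              lebesgue_cons (lebesgue_tuple n')]
  end.

Lemma lebesgue_tuple_box n (A : 'I_n -> set mR) :
  (forall i, measurable (A i)) ->
  lebesgue_tuple n [set t | forall i, A i (tnth t i)] =
  (\prod_(i < n) lebesgue_measure (A i))%E.
Proof.
elim: n A => [|n IH] A mA.
  rewrite big_ord0 /= diracE mem_set//; by case.
rewrite big_ord_recl -(IH (fun i => A (lift ord0 i)))//=.
rewrite /lebesgue_cons /pushforward.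
rewrite -product_measure1E//.
  congr (_ _); apply/seteqP; split=> -[x t] /=.
    move=> At; split=> [|i]; first exact: (At ord0).
    by have := At (lift ord0 i); rewrite tnthS.
  move=> [A0 At] i; case: (unliftP ord0 i) => [j|] -> //.
  by rewrite tnthS.
have -> : [set t : n.-tuple mR | forall i, A (lift ord0 i) (tnth t i)] =
    \bigcap_(i in [set: 'I_n]) ((fun t => tnth t i) @^-1` A (lift ord0 i)).
  by apply/seteqP; split=> t /= At i; [move=> _|]; exact: At.
apply: fin_bigcap_measurable => // i _.
by rewrite -[_ @^-1` _]setTI; exact: measurable_tnth.
Qed.

End lebesgue_tuple.

Section bernstein.
Context {R : realType} {n : nat}.
Local Notation Rn := 'rV[R]_n.
Local Notation C := R[i].

Definition row_of_tuple (t : n.-tuple (measurableTypeR R)) : Rn :=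
  \row_i tnth t i.

Definition volume (A : set Rn) : \bar R :=
  lebesgue_tuple n (row_of_tuple @^-1` A).

Definition cintegral (g : Rn -> C) : C :=
  ((\int[lebesgue_tuple n]_t complex.Re (g (row_of_tuple t))) +i*
   (\int[lebesgue_tuple n]_t complex.Im (g (row_of_tuple t))))%C.

Definition dot (x y : Rn) : R := \sum_(i < n) x ord0 i * y ord0 i.

(* [ball] on ['rV[R]_n] is a ball for the sup norm. *)
Definition euclidean_ball (c : Rn) (r : R) : set Rn :=
  [set x | Num.sqrt (dot (x - c) (x - c)) < r].

Definition partial (i : 'I_n) (g : Rn -> R) : Rn -> R :=
  fun x => 'D_(delta_mx ord0 i) g x.

(* ['D_v g x] is a meaningful value only where [derivable g x v]; [smooth]
   says that partial derivatives of all orders exist and are continuous. *)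
Definition smooth (g : Rn -> R) : Prop :=
  forall s : seq 'I_n, continuous (foldr partial g s) /\
    forall i x, derivable (foldr partial g s) x (delta_mx ord0 i).

Definition csmooth (phi : Rn -> C) : Prop :=
  smooth (fun x => complex.Re (phi x)) /\ smooth (fun x => complex.Im (phi x)).

Definition supp (phi : Rn -> C) : set Rn := closure [set t | phi t != 0].

Definition fourier (phi : Rn -> C) (x : Rn) : C :=
  cintegral (fun t => (cos (dot t x) -i* sin (dot t x))%C * phi t).

Definition spectrum_in (K : set Rn) (f : Rn -> C) : Prop :=
  forall phi : Rn -> C, csmooth phi ->
    (exists (c : Rn) (r : R), [/\ 0 < r, supp phi `<=` euclidean_ball c r &
       euclidean_ball c r `&` K = set0]) ->
    cintegral (fun x => f x * fourier phi x) = 0.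

(* [R[i]^o] carries the topology of the modulus; [Normc.normc] is the modulus
   with values in [R]. *)
Definition bernstein_space (K : set Rn) : set (Rn -> C) :=
  [set f | [/\ continuous (f : Rn -> R[i]^o),
    exists M : R, forall x, Normc.normc (f x) <= M &
    spectrum_in K f]].

(* For f in the Bernstein space both suprema are finite; [sup set0 = 0], so the
   empty set is not sampling unless the space is trivial. *)
Definition sampling_set (L : set Rn) (K : set Rn) : Prop :=
  exists2 c : R, 0 < c & forall f : Rn -> C, bernstein_space K f ->
    sup [set Normc.normc (f x) | x in [set: Rn]] <=
    c * sup [set Normc.normc (f x) | x in L].

Definition polar (K : set Rn) : set Rn :=
  [set x | forall t, K t -> dot x t <= 1].

Definition symmetric_convex_body (A : set Rn) : Prop :=
  [/\ compact A, convex_set A, A° !=set0 & A = [set - x | x in A]].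

End bernstein.

(* Main.v *)
Require Import Defs.
From mathcomp Require Import all_boot all_order all_algebra.
From mathcomp Require Import all_classical all_reals all_analysis.
From mathcomp Require Import complex.
From mathcomp Require Import measurable_realfun ring lra.
Import Order.TTheory GRing.Theory Num.Theory numFieldNormedType.Exports.
Local Open Scope classical_set_scope.
Local Open Scope ring_scope.

(** If [S] is contained in no [rho K^o] with [rho < pi / 2], compactness gives
    [s] in [S] and [t] in [K] with [s . t >= pi / 2]. The zero set of
    [f x = cos (t . x)] then meets every translate of the segment [[- s, s]], so
    it satisfies the covering condition, yet it is not a sampling set: [f 0 = 1].

    That [f] has spectrum in [K] amounts to Fourier inversion at a point [t]
    outside the support of [phi]. The integral of [f * fourier phi] is the limit
    of its truncations by [prod_j cos (a x_j) ^+ (2 n)] on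
    [|a x_j| <= pi / 2], as [a] tends to [0]. By Fubini a truncation is the
    pairing of [phi] with the Fourier transform of the cutoff, which is
    [O(a ^+ n)] uniformly at a positive distance from the origin. *)

Lemma integrable_mulrl d (T : measurableType d) (R : realType)
    (mu : {measure set T -> \bar R}) (D : set T) (f : T -> R) (c : R) :
  measurable D -> mu.-integrable D (EFin \o f) ->
  mu.-integrable D (EFin \o (fun x => c * f x)).
Proof. by move=> mD /(integrableZl mD c). Qed.

(** * Fourier integrals of cut-off cosine powers on the line *)

Section cos_power.
Context {R : realType}.
Implicit Types (a s d th x : R).

(** For [a > 0] the ends are the zeros of [cos (a * x)] nearest to the origin, so positive powers of
    it, cut off here, vanish at the ends. *)
Definition cos_interval a : set R := `[- (pi / 2 / a), pi / 2 / a]%classic.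

(** The phase [th] lets one real integral serve for both parts of the Fourier transform at [s]:
    [th = 0] is the cosine transform, [th = - (pi / 2)] the sine transform. *)
Definition cos_power_integral (N : nat) a s th : R :=
  \int[lebesgue_measure]_(x in cos_interval a)
    (cos (s * x + th) * cos (a * x) ^+ N).

Lemma continuous_cos_power N a s th :
  continuous (fun x => cos (s * x + th) * cos (a * x) ^+ N : R).
Proof.
move=> x; apply: cvgM.
  apply: (@cvg_comp _ _ _ (fun x => s * x + th) cos); last exact: continuous_cos.
  by apply: cvgD; [apply: cvgM; [exact: cvg_cst|exact: cvg_id]|exact: cvg_cst].
apply: (@cvg_comp _ _ _ (fun x => cos (a * x)) (fun y => y ^+ N));
  last exact: exprn_continuous.
apply: (@cvg_comp _ _ _ (fun x => a * x) cos); last exact: continuous_cos.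
by apply: cvgM; [exact: cvg_cst|exact: cvg_id].
Qed.

Lemma integrable_cos_power N a s th :
  lebesgue_measure.-integrable (cos_interval a)
    (EFin \o (fun x => cos (s * x + th) * cos (a * x) ^+ N)).
Proof.
apply: continuous_compact_integrable; first exact: segment_compact.
by apply: continuous_subspaceT; exact: continuous_cos_power.
Qed.

(* The integrand is [W'] for the Wronskian [W = f g' - f' g] of
   [f = cos (s x + th)] and [g = cos (a x) ^+ m.+2]; [W] vanishes at both ends. *)
Lemma cos_power_integral_rec m a s th : 0 < a ->
  (s ^+ 2 - (a * m.+2%:R) ^+ 2) * cos_power_integral m.+2 a s th =
  - (a ^+ 2 * (m.+2 * m.+1)%:R) * cos_power_integral m a s th.
Proof.
move=> a0.
pose W x := s * sin (s * x + th) * cos (a * x) ^+ m.+2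
  - a * m.+2%:R * cos (s * x + th) * (cos (a * x) ^+ m.+1 * sin (a * x)).
pose w x := (s ^+ 2 - (a * m.+2%:R) ^+ 2) * (cos (s * x + th) * cos (a * x) ^+ m.+2)
  + a ^+ 2 * (m.+2 * m.+1)%:R * (cos (s * x + th) * cos (a * x) ^+ m).
have dl0 (c x : R) : is_derive x 1 (fun x => c * x : R) c.
  apply: (is_derive_eq (is_deriveZ c (is_derive_id x 1))).
  by rewrite /GRing.scale/= mulr1.
have dl (c e x : R) : is_derive x 1 (fun x => c * x + e : R) c.
  by apply: (is_derive_eq (is_deriveD (dl0 c x) (is_derive_cst e x 1))); rewrite addr0.
have dcs x : is_derive x 1 (fun x => cos (s * x + th)) (- sin (s * x + th) * s).
  exact: (@is_derive1_comp _ cos (fun x => s * x + th)).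
have dsn x : is_derive x 1 (fun x => sin (s * x + th)) (cos (s * x + th) * s).
  exact: (@is_derive1_comp _ sin (fun x => s * x + th)).
have dca x : is_derive x 1 (fun x => cos (a * x)) (- sin (a * x) * a).
  exact: (@is_derive1_comp _ cos (fun x => a * x)).
have dsa x : is_derive x 1 (fun x => sin (a * x)) (cos (a * x) * a).
  exact: (@is_derive1_comp _ sin (fun x => a * x)).
have dX k x : is_derive x 1 (fun x => cos (a * x) ^+ k)
    (k%:R * cos (a * x) ^+ k.-1 * (- sin (a * x) * a)).
  have h := is_deriveX k (dca x).
  have <- : (fun x => cos (a * x)) ^+ k = (fun x => cos (a * x) ^+ k).
    by apply/funext => y; rewrite fctE.
  exact: h.
have dW x : is_derive x 1 W (w x).
  have d1 := is_deriveM (is_deriveZ s (dsn x)) (dX m.+2 x).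
  have d2 := is_deriveM (is_deriveZ (a * m.+2%:R) (dcs x))
    (is_deriveM (dX m.+1 x) (dsa x)).
  apply: (is_derive_eq (is_deriveB d1 d2)).
  rewrite -[((fun _ => _) * (fun _ => _)) x]/(cos (a * x) ^+ m.+1 * sin (a * x)).
  (* [w] is the derivative of [W] modulo [sin ^+ 2 = 1 - cos ^+ 2]; the trigonometric values become
     variables so that [ring] can use this relation. *)
  have := sin2cos2 (a * x); rewrite /w /GRing.scale/= natrM.
  rewrite /GRing.scale/= !(exprS _ m.+1) !(exprS _ m) !expr2.
  rewrite -[m.+2%:R]natr1; move: (m.+1%:R : R) (sin (s * x + th)) (cos (s * x + th)).
  move: (sin (a * x)) (cos (a * x)) => S C; move: (C ^+ m).
  move=> P M1 F' F e2.
  ring: e2.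
have end0 x : cos (a * x) = 0 -> W x = 0.
  by rewrite /W => ->; rewrite !exprS !mul0r !mulr0 subr0.
have aK : a * (pi / 2 / a) = pi / 2 by rewrite mulrCA divff ?mulr1 ?gt_eqF.
have cW : continuous W.
  by move=> x; apply/differentiable_continuous/derivable1_diffP; have [] := dW x.
have ab : - (pi / 2 / a) < pi / 2 / a.
  by rewrite gtrN// divr_gt0// divr_gt0 ?pi_gt0.
have ie : \int[lebesgue_measure]_(x in cos_interval a) w x = 0.
  rewrite /Rintegral (@continuous_FTC2 _ w W _ _ ab); last 3 first.
  - apply: continuous_subspaceT => x.
    rewrite /w; apply: cvgD; apply: cvgM; try exact: cvg_cst; exact: continuous_cos_power.
  - by split; [move=> x _; have [] := dW x|exact/cvg_at_right_filter/cW|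
      exact/cvg_at_left_filter/cW].
  - by move=> x _; rewrite derive1E; exact: derive_val.
  by rewrite !end0 ?mulrN ?cosN ?aK ?cos_pihalf// -EFinB subrr.
move: ie; rewrite RintegralD//=; last 3 first.
- exact: measurable_itv.
- by apply: integrable_mulrl; [exact: measurable_itv|exact: integrable_cos_power].
- by apply: integrable_mulrl; [exact: measurable_itv|exact: integrable_cos_power].
rewrite !RintegralZl//; last 4 first.
- exact: measurable_itv.
- exact: integrable_cos_power.
- exact: measurable_itv.
- exact: integrable_cos_power.
by move/eqP; rewrite addr_eq0 => /eqP; rewrite mulNr.
Qed.

(** The integrand has modulus at most 1 and the interval has length [pi / a]. *)
Lemma cos_power_integral_bound N a s th : 0 < a ->
  `|cos_power_integral N a s th| <= pi / a.
Proof.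
move=> a0; rewrite /cos_power_integral.
have mI : measurable (cos_interval a : set (measurableTypeR R)) by exact: measurable_itv.
have h := le_normr_Rintegral mI (integrable_cos_power N a s th).
apply: (le_trans h).
have I1 : lebesgue_measure.-integrable (cos_interval a) (EFin \o cst (1 : R)).
  apply: continuous_compact_integrable; first exact: segment_compact.
  by apply: continuous_subspaceT; exact: cst_continuous.
apply: (@le_trans _ _ (\int[lebesgue_measure]_(x in cos_interval a) 1)).
  apply: le_Rintegral => //.
    exact: (integrable_norm (integrable_cos_power N a s th)).
  move=> x _; rewrite normrM normrX mulr_ile1 ?exprn_ge0 ?cos_max//.
  by rewrite exprn_ile1 ?cos_max.
rewrite Rintegral_cst// mul1r.
rewrite [X in fine X](_ : _ = (pi / a)%:E)//.
  etransitivity; first exact: lebesgue_measure_itv.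
  have h' : 0 < pi / 2 / a by rewrite divr_gt0// divr_gt0 ?pi_gt0.
  by rewrite /= lte_fin gtrN// -EFinD opprK -mulrDl -splitr.
Qed.

(* With [M = n] the factor [a ^+ (2 n)] beats the [(pi / a) ^+ n] that comes
   from [n] coordinates. *)
Lemma cos_power_integral_decay M a s th d : 0 < a -> 0 < d ->
  2 * a * M.*2%:R <= d -> d <= `|s| ->
  `|cos_power_integral M.*2 a s th| <=
    (2 * M.*2%:R ^+ 2 / d ^+ 2 * a ^+ 2) ^+ M * (pi / a).
Proof.
move=> a0 d0; elim: M => [|M IH] ad ds.
  by rewrite expr0 mul1r cos_power_integral_bound.
have a0' := ltW a0.
have a20 : 0 <= a ^+ 2 by rewrite exprn_ge0.
have MM : M.*2%:R <= M.+1.*2%:R :> R by rewrite ler_nat leq_double.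
have ad' : 2 * a * M.*2%:R <= d.
  by apply: le_trans ad; rewrite ler_wpM2l// mulr_ge0.
have := IH ad' ds; set J := cos_power_integral M.*2 a s th => JB.
have := cos_power_integral_rec M.*2 a s th a0; rewrite -doubleS -/J.
set I := cos_power_integral _ _ _ _ => e.
have aM0 : 0 <= a * M.+1.*2%:R by rewrite mulr_ge0.
(* The smallness of [a] keeps the factor on the left of the recurrence above [3 / 4 * d ^+ 2].
   Dividing by it costs [4 / 3], which the constant 2 in [A] absorbs. *)
have aMd : (a * M.+1.*2%:R) ^+ 2 <= d ^+ 2 / 4.
  have : a * M.+1.*2%:R <= d / 2 by rewrite ler_pdivlMr// mulrC mulrA.
  nra.
have sd : d ^+ 2 <= s ^+ 2.
  by rewrite -[leRHS]real_normK ?num_real// lerXn2r ?nnegrE// ltW.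
have s2 : 3 / 4 * d ^+ 2 <= s ^+ 2 - (a * M.+1.*2%:R) ^+ 2 by lra.
have d20 : 0 < d ^+ 2 by rewrite exprn_gt0.
set A := 2 * M.+1.*2%:R ^+ 2 / d ^+ 2 * a ^+ 2.
have d2V : 0 <= (d ^+ 2)^-1 by rewrite invr_ge0 ltW.
have A0 : 0 <= A by rewrite /A; do 3?[apply: mulr_ge0 => //]; rewrite exprn_ge0.
have IJ : `|I| <= A * `|J|.
  have : 3 / 4 * d ^+ 2 * `|I| <= a ^+ 2 * (M.*2.+2 * M.*2.+1)%:R * `|J|.
    have := congr1 Num.norm e; rewrite normrM [RHS]normrM normrN => e1.
    apply: (@le_trans _ _ (`|s ^+ 2 - (a * M.+1.*2%:R) ^+ 2| * `|I|)).
      by rewrite ler_wpM2r// (le_trans s2)// ler_norm.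
    by rewrite e1 [`|_ * _%:R|]ger0_norm ?mulr_ge0.
  have : a ^+ 2 * (M.*2.+2 * M.*2.+1)%:R * `|J| <= a ^+ 2 * M.+1.*2%:R ^+ 2 * `|J|.
    by rewrite ler_wpM2r// ler_wpM2l// -natrX ler_nat doubleS leq_mul.
  move=> h1 h2; have h3 := le_trans h2 h1.
  have -> : A * `|J| = 2 * M.+1.*2%:R ^+ 2 * a ^+ 2 * `|J| / d ^+ 2.
    by rewrite /A; ring.
  rewrite ler_pdivlMr//.
  have := mulr_ge0 (ltW d20) (normr_ge0 I); nra.
apply: (le_trans IJ); rewrite exprS -mulrA ler_wpM2l//.
apply: (le_trans JB); rewrite ler_wpM2r ?divr_ge0 ?pi_ge0//.
(* The induction hypothesis carries the constant for [M], which is at most [A]. *)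
have A'0 : 0 <= 2 * M.*2%:R ^+ 2 / d ^+ 2 * a ^+ 2.
  by do 3?[apply: mulr_ge0 => //]; rewrite exprn_ge0.
by rewrite lerXn2r ?nnegrE// /A ler_wpM2r// ler_wpM2r// ler_wpM2l// lerXn2r ?nnegrE.
Qed.
End cos_power.

(** * Integrability of bounded functions on sets of finite measure *)

Lemma integrable_bounded_support d (T : measurableType d) (R : realType)
    (mu : {measure set T -> \bar R}) (D : set T) (f : T -> R) (M : R) :
  measurable D -> (mu D < +oo)%E -> measurable_fun [set: T] f ->
  (forall x, D x -> `|f x| <= M) -> (forall x, ~ D x -> f x = 0) ->
  mu.-integrable [set: T] (EFin \o f).
Proof.
move=> mD muD mf fM f0.
rewrite (_ : f = f \_ D); last first.
  apply/funext => x; rewrite patchE; case: ifPn => // /negP xD.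
  by apply: f0 => Dx; apply: xD; rewrite inE.
rewrite -restrict_EFin; apply/integrable_restrict => //; rewrite setTI.
apply: measurable_bounded_integrable => //; first exact: measurable_funTS.
exists M; split; first exact: num_real.
by move=> y My x Dx; exact: le_trans (fM x Dx) (ltW My).
Qed.

Lemma product_measure1_lty d1 d2 (T1 : measurableType d1) (T2 : measurableType d2)
    (R : realType) (m1 : {sigma_finite_measure set T1 -> \bar R})
    (m2 : {sigma_finite_measure set T2 -> \bar R}) (A : set T1) (B : set T2) :
  measurable A -> measurable B -> (m1 A < +oo)%E -> (m2 B < +oo)%E ->
  ((m1 \x m2)%E (A `*` B) < +oo)%E.
Proof.
move=> mA mB Aoo Boo; rewrite product_measure1E//.
by rewrite lte_mul_pinfty// ge0_fin_numE.
Qed.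

(** * Integrals of cosines against the product cutoff in n variables *)

Section tuple_integral.
Context {R : realType}.
Local Notation mR := (measurableTypeR R).

(** The measure in dimension [n.+1] is by construction the pushforward of a product, so this is a
    change of variables followed by Fubini. Integrability of every section makes the inner real
    integral, a [fine], agree with the extended one at each [x]. *)
Lemma Rintegral_lebesgue_tupleS n (f : n.+1.-tuple mR -> R) :
  measurable_fun [set: n.+1.-tuple mR] f ->
  ((@lebesgue_measure R) \x (lebesgue_tuple n))%E.-integrable setT
    (EFin \o (f \o @cons_pair R n)) ->
  (forall x, (lebesgue_tuple n).-integrable setT
    (EFin \o (fun y => f (cons_pair (x, y))))) ->
  \int[lebesgue_tuple n.+1]_x f x =
  \int[@lebesgue_measure R]_x \int[lebesgue_tuple n]_y f (cons_pair (x, y)).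
Proof.
move=> mf If If'.
have mp := @measurable_cons_pair R n.
rewrite /Rintegral.
have -> : (\int[lebesgue_tuple n.+1]_x (f x)%:E =
   \int[pushforward ((@lebesgue_measure R) \x (lebesgue_tuple n))%E (@cons_pair R n)]_x (f x)%:E)%E.
  exact: eq_measure_integral.
rewrite integral_pushforward//; last exact/measurable_EFinP.
rewrite -integral12_prod_meas1//; congr fine.
apply: eq_integral => x _; rewrite /fubini_F/= fineK//.
by apply: integrable_fin_num => //; exact: If'.
Qed.

(** The frequency is a function of the index, so that rows [v ord0], tuples [tnth x] and their sums
    and differences can all take its place. *)
Definition phase n (s : 'I_n -> R) (x : n.-tuple mR) : R :=
  \sum_(i < n) s i * tnth x i.

Definition cutoff1 (N : nat) (a : R) : mR -> R :=
  fun x => \1_(cos_interval a) x * cos (a * x) ^+ N.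

Definition cutoff n (N : nat) (a : R) (x : n.-tuple mR) : R :=
  \prod_(i < n) cutoff1 N a (tnth x i).

Lemma measurable_phase n (s : 'I_n -> R) :
  measurable_fun [set: n.-tuple mR] (phase n s).
Proof.
apply: measurable_sum => i; apply: measurable_funM => //.
exact: measurable_tnth.
Qed.

Lemma measurable_cosT d (T : measurableType d) (f : T -> R) :
  measurable_fun [set: T] f -> measurable_fun [set: T] (fun x => cos (f x)).
Proof.
apply: (@measurableT_comp _ _ _ _ _ _ (@cos R)).
by apply: continuous_measurable_fun; exact: continuous_cos.
Qed.

Lemma measurable_cutoff1 N a : measurable_fun [set: mR] (cutoff1 N a).
Proof.
apply: measurable_funM; first by apply: measurable_indic; exact: measurable_itv.
by apply: measurable_funX; apply: measurable_cosT; apply: measurable_funM.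
Qed.

Lemma measurable_cutoff n N a : measurable_fun [set: n.-tuple mR] (cutoff n N a).
Proof.
apply: measurable_prod => i _.
apply: measurableT_comp; [exact: measurable_cutoff1|exact: measurable_tnth].
Qed.

Definition cos_box n (a : R) : set (n.-tuple mR) :=
  [set x | forall i, cos_interval a (tnth x i)].

Lemma measurable_box n (A : 'I_n -> set mR) : (forall i, measurable (A i)) ->
  measurable [set x : n.-tuple mR | forall i, A i (tnth x i)].
Proof.
move=> mA.
have -> : [set x : n.-tuple mR | forall i, A i (tnth x i)] =
    \bigcap_(i in [set: 'I_n]) ((fun t => tnth t i) @^-1` A i).
  by apply/seteqP; split=> t /= At i; [move=> _|]; exact: At.
apply: fin_bigcap_measurable => // i _.
by rewrite -[_ @^-1` _]setTI; exact: measurable_tnth.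
Qed.

Lemma lebesgue_tuple_box_lty n (l u : 'I_n -> R) :
  (lebesgue_tuple n
    [set x : n.-tuple mR | forall i, `[l i, u i]%classic (tnth x i)] < +oo)%E.
Proof.
rewrite (@lebesgue_tuple_box _ _ (fun i => `[l i, u i]%classic : set mR)); last first.
  by move=> i; exact: measurable_itv.
rewrite -ge0_fin_numE; last by apply: prode_ge0.
apply: prode_fin_num => i _.
have -> : lebesgue_measure (`[l i, u i]%classic : set mR) =
    (if (l i < u i)%R then (u i)%:E - (l i)%:E else 0)%E.
  exact: lebesgue_measure_itv.
by case: ifP.
Qed.

Lemma cos_box_lty n a : (lebesgue_tuple n (cos_box n a) < +oo)%E.
Proof. exact: lebesgue_tuple_box_lty. Qed.

Lemma measurable_cos_box n a : measurable (cos_box n a).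
Proof.
have mI : measurable (cos_interval a : set mR) by exact: measurable_itv.
exact: (@measurable_box n (fun=> (cos_interval a : set mR)) (fun=> mI)).
Qed.

Lemma cutoff0 n N a (x : n.-tuple mR) : ~ cos_box n a x -> cutoff n N a x = 0.
Proof.
move=> /existsNP[i xi]; rewrite /cutoff (bigD1 i)//= /cutoff1.
by rewrite indicE memNset// !mul0r.
Qed.

Lemma cutoff_le1 n N a (x : n.-tuple mR) : `|cutoff n N a x| <= 1.
Proof.
rewrite normr_prod prodr_ile1// => i _; rewrite normr_ge0/= normrM.
by rewrite mulr_ile1// ?normrX ?exprn_ge0 ?exprn_ile1 ?cos_max// indicE; case: (_ \in _);
  rewrite ?normr1 ?normr0.
Qed.

Lemma measurable_cos_phase n (s : 'I_n -> R) th :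
  measurable_fun [set: n.-tuple mR] (fun x => cos (phase n s x + th)).
Proof.
by apply: measurable_cosT; apply: measurable_funD => //; exact: measurable_phase.
Qed.

Lemma integrable_cos_cutoff n N a s th :
  (lebesgue_tuple n).-integrable setT
    (EFin \o (fun x => cos (phase n s x + th) * cutoff n N a x)).
Proof.
apply: (@integrable_bounded_support _ _ _ _ (cos_box n a) _ 1).
- exact: measurable_cos_box.
- exact: cos_box_lty.
- apply: measurable_funM; [exact: measurable_cos_phase|exact: measurable_cutoff].
- by move=> x _; rewrite normrM mulr_ile1// ?cos_max ?cutoff_le1.
- by move=> x /cutoff0 ->; rewrite mulr0.
Qed.

Lemma cos_interval_lty a :
  (@lebesgue_measure R (cos_interval a : set mR) < +oo)%E.
Proof.
have -> : lebesgue_measure (cos_interval a : set mR) =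
    (if (- (pi / 2 / a) < pi / 2 / a)%R
     then (pi / 2 / a)%:E - (- (pi / 2 / a))%:E else 0)%E.
  exact: lebesgue_measure_itv.
by case: ifP => _; rewrite ltry.
Qed.

Lemma integrable_cos_cutoff1 N a s th :
  (@lebesgue_measure R).-integrable [set: mR]
    (EFin \o (fun x => cos (s * x + th) * cutoff1 N a x)).
Proof.
apply: (@integrable_bounded_support _ mR R (@lebesgue_measure R)
  (cos_interval a) _ 1).
- exact: measurable_itv.
- exact: cos_interval_lty.
- apply: measurable_funM; last exact: measurable_cutoff1.
  by apply: measurable_cosT; apply: measurable_funD => //; exact: measurable_funM.
- move=> x _; rewrite /cutoff1 mulrCA normrM indicE.
  rewrite mulr_ile1//; first by case: (_ \in _); rewrite ?normr1 ?normr0.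
  by rewrite normrM normrX mulr_ile1 ?exprn_ge0 ?exprn_ile1 ?cos_max.
- by move=> x xI; rewrite /cutoff1 indicE memNset// mul0r mulr0.
Qed.

Lemma cutoff1E N a s th :
  \int[@lebesgue_measure R]_x (cos (s * x + th) * cutoff1 N a x) =
  cos_power_integral N a s th.
Proof.
rewrite /cos_power_integral [RHS]Rintegral_mkcond; apply: eq_Rintegral => x _.
rewrite patchE /cutoff1 indicE; case: (x \in _).
  by rewrite mul1r.
by rewrite mul0r mulr0.
Qed.

Definition cutoff_cos_integral n N a (s : 'I_n -> R) th : R :=
  \int[lebesgue_tuple n]_x (cos (phase n s x + th) * cutoff n N a x).

(** Fubini separates the first coordinate, and [cos (A + B) = cos A * cos B - sin A * sin B] splits
    the integrand into two products; each sine is a cosine with its phase moved by [- (pi / 2)]. *)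
Lemma cutoff_cos_integralS n N a (s : 'I_n.+1 -> R) th :
  let s' i := s (lift ord0 i) in
  cutoff_cos_integral n.+1 N a s th =
    cos_power_integral N a (s ord0) th * cutoff_cos_integral n N a s' 0
    - cos_power_integral N a (s ord0) (th - pi / 2)
      * cutoff_cos_integral n N a s' (- (pi / 2)).
Proof.
move=> s'.
have phaseS x y : phase n.+1 s (cons_pair (x, y)) = s ord0 * x + phase n s' y.
  rewrite /phase big_ord_recl/=; congr (_ + _).
  by apply: eq_bigr => i _; rewrite tnthS.
have cutoffS x y : cutoff n.+1 N a (cons_pair (x, y)) = cutoff1 N a x * cutoff n N a y.
  rewrite /cutoff big_ord_recl/=; congr (_ * _).
  by apply: eq_bigr => i _; rewrite tnthS.
rewrite /cutoff_cos_integral Rintegral_lebesgue_tupleS; last 3 first.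
- apply: measurable_funM; [exact: measurable_cos_phase|exact: measurable_cutoff].
- apply: (@integrable_bounded_support _ (mR * n.-tuple mR)%type R
      (@lebesgue_measure R \x lebesgue_tuple n)%E
      ((cos_interval a : set mR) `*` cos_box n a) _ 1).
  + by apply: measurableX; [exact: measurable_itv|exact: measurable_cos_box].
  + apply: product_measure1_lty; [exact: measurable_itv|exact: measurable_cos_box|
      exact: cos_interval_lty|exact: cos_box_lty].
  + apply: (@measurableT_comp _ _ _ _ _ _
      (fun x => cos (phase n.+1 s x + th) * cutoff n.+1 N a x)).
      by apply: measurable_funM; [exact: measurable_cos_phase|exact: measurable_cutoff].
    exact: measurable_cons_pair.
  + by move=> x _ /=; rewrite normrM mulr_ile1// ?cos_max ?cutoff_le1.
  + move=> -[x y] xy /=; rewrite cutoffS.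
    have [xI|xI] := pselect (cos_interval a x); last first.
      by rewrite /cutoff1 indicE memNset// !mul0r mulr0.
    by rewrite (@cutoff0 _ _ _ y) ?mulr0// => yB; apply: xy.
- move=> x.
  rewrite (_ : (fun _ => _) = fun y => cutoff1 N a x *
    (cos (phase n s' y + (s ord0 * x + th)) * cutoff n N a y)).
    by apply: integrable_mulrl => //; exact: integrable_cos_cutoff.
  apply/funext => y; rewrite phaseS cutoffS [s _ * _ + _]addrC -addrA; ring.
pose A t := \int[lebesgue_tuple n]_y (cos (phase n s' y + t) * cutoff n N a y).
transitivity (\int[@lebesgue_measure R]_x
    (A 0 * (cos (s ord0 * x + th) * cutoff1 N a x) -
     A (- (pi / 2)) * (cos (s ord0 * x + (th - pi / 2)) * cutoff1 N a x))).
  apply: eq_Rintegral => x _.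
  transitivity (\int[lebesgue_tuple n]_y
   (cutoff1 N a x * cos (s ord0 * x + th) * (cos (phase n s' y + 0) * cutoff n N a y)
    - cutoff1 N a x * sin (s ord0 * x + th) *
        (cos (phase n s' y + - (pi / 2)) * cutoff n N a y))).
    apply: eq_Rintegral => y _; rewrite phaseS cutoffS addr0 cosBpihalf.
    rewrite -addrA [phase _ _ _ + _]addrC addrA cosD; ring.
  rewrite RintegralB//; last 2 first.
    by apply: integrable_mulrl => //; exact: integrable_cos_cutoff.
    by apply: integrable_mulrl => //; exact: integrable_cos_cutoff.
  rewrite !RintegralZl//; last 2 first.
    exact: integrable_cos_cutoff.
    exact: integrable_cos_cutoff.
  rewrite -/(A _) -/(A _) addrA cosBpihalf; ring.
rewrite RintegralB//; last 2 first.
- by apply: integrable_mulrl => //; exact: integrable_cos_cutoff1.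
- by apply: integrable_mulrl => //; exact: integrable_cos_cutoff1.
rewrite !RintegralZl//; last 2 first.
- exact: integrable_cos_cutoff1.
- exact: integrable_cos_cutoff1.
by rewrite !cutoff1E /A mulrC [X in _ - X]mulrC.
Qed.

(** Induction on the dimension: splitting off a coordinate produces two products, hence a factor 2
    each time. The bound [b] must be uniform in the phase because the splitting changes it. *)
Lemma cutoff_cos_integral_le n N a (s b : 'I_n -> R) th :
  (forall i t, `|cos_power_integral N a (s i) t| <= b i) ->
  `|cutoff_cos_integral n N a s th| <= \prod_(i < n) (2 * b i).
Proof.
elim: n s b th => [|n IH] s b th sb.
  (* In dimension 0 the measure is a unit mass at the empty tuple, and the integrand there is at
     most 1, the empty product. *)
  rewrite big_ord0 /cutoff_cos_integral /Rintegral.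
  have -> : (\int[lebesgue_tuple 0]_x
      (cos (phase 0 s x + th) * cutoff 0 N a x)%:E = 
      \int[dirac ([tuple] : 0.-tuple mR)]_x (cos (phase 0 s x + th) * cutoff 0 N a x)%:E)%E.
    exact: eq_measure_integral.
  rewrite integral_dirac//; last first.
    apply/measurable_EFinP.
    by apply: measurable_funM; [exact: measurable_cos_phase|exact: measurable_cutoff].
  rewrite diracT mul1e/= normrM mulr_ile1 ?cos_max ?cutoff_le1//.
rewrite cutoff_cos_integralS big_ord_recl.
set s' := fun i => s (lift ord0 i).
have sb' i t : `|cos_power_integral N a (s' i) t| <= b (lift ord0 i) by exact: sb.
apply: (le_trans (ler_normB _ _)); rewrite !normrM -mulrA [leRHS]mulr_natl mulr2n.
by apply: lerD; apply: ler_pM => //; apply: IH.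
Qed.

End tuple_integral.

(** The integral is the difference of those of [f^\+] and [f^\-]. It is infinite as soon as one of
    them is, even for [+oo - +oo], so a finite value forces both to be finite. *)
Lemma integrable_fin_num_integral d (T : measurableType d) (R : realType)
    (mu : {measure set T -> \bar R}) (f : T -> \bar R) :
  measurable_fun [set: T] f -> (\int[mu]_x f x \is a fin_num)%E ->
  mu.-integrable [set: T] f.
Proof.
move=> mf; rewrite integralE => intf.
apply/integrableP; split => //.
have p0 : (0 <= \int[mu]_x f^\+ x)%E by apply: integral_ge0.
have n0 : (0 <= \int[mu]_x f^\- x)%E by apply: integral_ge0.
have -> : (\int[mu]_x `|f x| = \int[mu]_x f^\+ x + \int[mu]_x f^\- x)%E.
  rewrite -ge0_integralD//; last 2 first.
  - exact: measurable_funepos.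
  - exact: measurable_funeneg.
  by apply: eq_integral => x _; rewrite -/((abse \o f) x) fune_abse.
move: intf p0 n0; case: (\int[mu]_x f^\+ x)%E => [r||]; case: (\int[mu]_x f^\- x)%E => [s||] //=.
by rewrite ltry.
Qed.

(** * Removal of the cutoff and vanishing of the pairing *)

Section truncation.
Context {R : realType}.
Local Notation mR := (measurableTypeR R).

(** The interval eventually contains the fixed point [x]; from then on only the power of
    [cos (a * x)] remains, with [a * x] tending to 0. *)
Lemma cvg_cutoff1 N (x : mR) : cutoff1 N (harmonic k : R) x @[k --> \oo] --> (1 : R).
Proof.
have cosx : cos (harmonic k * x : R) ^+ N @[k --> \oo] --> (1 : R).
  rewrite -(expr1n _ N) -cos0.
  apply: (@cvg_comp _ _ _ (fun k => cos (harmonic k * x)) (fun y => y ^+ N));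
    last exact: exprn_continuous.
  apply: (@cvg_comp _ _ _ (fun k => harmonic k * x) cos); last exact: continuous_cos.
  have -> : nbhs (0 : R) = nbhs (0 * x : R) by rewrite mul0r.
    apply: cvgM; [exact: cvg_harmonic|exact: cvg_cst].
apply: cvg_trans cosx; apply: near_eq_cvg.
have : \forall k \near \oo, `|harmonic k * x| <= pi / 2.
  have : harmonic k * x @[k --> \oo] --> (0 : R).
    have -> : nbhs (0 : R) = nbhs (0 * x : R) by rewrite mul0r.
    apply: cvgM; [exact: cvg_harmonic|exact: cvg_cst].
  move/cvgr0_norm_le; apply; rewrite divr_gt0 ?pi_gt0//.
apply: filterS => k; rewrite ler_norml => /andP[l u].
rewrite /cutoff1 indicE mem_set ?mul1r//.
have h0 : 0 < harmonic k :> R by rewrite /harmonic/= invr_gt0.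
move: (harmonic k : R) h0 l u => a a0 l u.
have l' : - (pi / 2 / a) <= (x : R) by rewrite -mulNr ler_pdivrMr// [leRHS]mulrC.
have u' : (x : R) <= pi / 2 / a by rewrite ler_pdivlMr// [leLHS]mulrC.
have h : cos_interval a x = (- (pi / 2 / a) <= x <= pi / 2 / a) by rewrite /cos_interval/= in_itv.
by rewrite h; apply/andP.
Qed.

Lemma cvg_cutoff n N (x : n.-tuple mR) :
  cutoff n N (harmonic k : R) x @[k --> \oo] --> (1 : R).
Proof.
rewrite /cutoff; elim: (index_enum _) => [|i r IH].
  by under eq_fun do rewrite big_nil; exact: cvg_cst.
under eq_fun do rewrite big_cons.
have -> : nbhs (1 : R) = nbhs (1 * 1 : R) by rewrite mulr1.
    apply: cvgM; [exact: cvg_cutoff1|exact: IH].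
Qed.

(* No integrability of [h] is required: a non-integrable [h] has an infinite
   extended integral, for which [Rintegral] is [0]. *)
Lemma Rintegral_eq0_truncation n N (h : n.-tuple mR -> R) :
  (forall k, measurable_fun [set: n.-tuple mR]
    (fun x => h x * cutoff n N (harmonic k) x)) ->
  \int[lebesgue_tuple n]_x (h x * cutoff n N (harmonic k) x) @[k --> \oo] --> (0 : R) ->
  \int[lebesgue_tuple n]_x h x = 0.
Proof.
move=> mhc int0.
have hcvg x : (h x * cutoff n N (harmonic k) x)%:E @[k --> \oo] --> (h x)%:E.
  apply: cvg_EFin; first exact: nearW.
  have -> : nbhs (h x) = nbhs (h x * 1) by rewrite mulr1.
    apply: cvgM; [exact: cvg_cst|exact: cvg_cutoff].
have mh : measurable_fun [set: n.-tuple mR] (EFin \o h).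
  apply: (emeasurable_fun_cvg (fun k x => (h x * cutoff n N (harmonic k) x)%:E)) => //.
  by move=> k; exact/measurable_EFinP.
have [fi|] := boolP (\int[lebesgue_tuple n]_x (h x)%:E \is a fin_num)%E; last first.
  by rewrite /Rintegral; case: (\int[_]_x _)%E.
have ih := integrable_fin_num_integral _ _ _ _ _ mh fi.
have hb x k : [set: n.-tuple mR] x ->
    (`|(h x * cutoff n N (harmonic k) x)%:E| <= `|(EFin \o h) x|)%E.
  by move=> _; rewrite /= lee_fin normrM ler_piMr// cutoff_le1.
have [_ _ dc] := @dominated_convergence _ _ R (lebesgue_tuple n) setT measurableT
  (fun k x => (h x * cutoff n N (harmonic k) x)%:E) (EFin \o h)
  (abse \o (EFin \o h)) (fun k => (measurable_EFinP _ _).2 (mhc k)) mh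
  (aeW _ (fun x _ => hcvg x)) (integrable_abse ih)
  (aeW _ (fun x k => hb x k)).
move: dc; rewrite -(fineK fi) => /fine_cvg dc.
by apply: cvg_unique dc int0.
Qed.

(* Real and imaginary parts of a Fourier transform have this form; [sin y] is
   written [cos (y - pi / 2)]. *)
Definition trig_transform n (p q : n.-tuple mR -> R) (x : n.-tuple mR) : R :=
  \int[lebesgue_tuple n]_t
    (cos (phase n (tnth x) t) * p t + cos (phase n (tnth x) t - pi / 2) * q t).

(** * The truncated pairing, integrated in both orders *)

Section pairing.
Variables (n N : nat) (t0 : 'I_n -> R) (p q : n.-tuple mR -> R) (M : R).
Variables (l u : 'I_n -> R).
Let box := [set t : n.-tuple mR | forall i, `[l i, u i]%classic (tnth t i)].
Hypotheses (mp : measurable_fun [set: n.-tuple mR] p)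
           (mq : measurable_fun [set: n.-tuple mR] q)
           (pM : forall t, `|p t| <= M) (qM : forall t, `|q t| <= M)
           (p0 : forall t, ~ box t -> p t = 0)
           (q0 : forall t, ~ box t -> q t = 0).
Local Notation mu := (lebesgue_tuple n).

Let mbox : measurable box.
Proof.
by apply: (@measurable_box R n (fun i => `[l i, u i]%classic : set mR)) => i;
  exact: measurable_itv.
Qed.

(** The truncated pairing before either integration: [z.1] is the space variable, cut off, and [z.2]
    is the frequency variable, confined to [box] by [p] and [q]. *)
Let kernel a (z : n.-tuple mR * n.-tuple mR) : R :=
  cos (phase n t0 z.1) * cutoff n N a z.1 *
  (cos (phase n (tnth z.1) z.2) * p z.2 + cos (phase n (tnth z.1) z.2 - pi / 2) * q z.2).

Let measurable_phase2 :
  measurable_fun [set: n.-tuple mR * n.-tuple mR] (fun z => phase n (tnth z.1) z.2).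
Proof.
apply: measurable_sum => i; apply: measurable_funM.
  by apply: (@measurableT_comp _ _ _ _ _ _ (fun t : n.-tuple mR => tnth t i));
    [exact: measurable_tnth|exact: measurable_fst].
by apply: (@measurableT_comp _ _ _ _ _ _ (fun t : n.-tuple mR => tnth t i));
    [exact: measurable_tnth|exact: measurable_snd].
Qed.

Let measurable_kernel a : measurable_fun [set: n.-tuple mR * n.-tuple mR] (kernel a).
Proof.
apply: measurable_funM; first apply: measurable_funM.
- apply: measurable_cosT.
  by apply: measurableT_comp; [exact: measurable_phase|exact: measurable_fst].
- by apply: measurableT_comp; [exact: measurable_cutoff|exact: measurable_fst].
apply: measurable_funD; apply: measurable_funM.
- exact: measurable_cosT.
- by apply: measurableT_comp; [exact: mp|exact: measurable_snd].
- by apply: measurable_cosT; exact: measurable_funB.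
- by apply: measurableT_comp; [exact: mq|exact: measurable_snd].
Qed.

Let integrable_kernel a : (mu \x mu)%E.-integrable setT (EFin \o kernel a).
Proof.
apply: (@integrable_bounded_support _ (n.-tuple mR * n.-tuple mR)%type R (mu \x mu)%E
  (cos_box n a `*` box) _ (M + M)).
- by apply: measurableX => //; exact: measurable_cos_box.
- apply: product_measure1_lty => //; [exact: measurable_cos_box|exact: cos_box_lty|
    exact: lebesgue_tuple_box_lty].
- exact: measurable_kernel.
- move=> z _; rewrite /kernel normrM -[leRHS]mul1r ler_pM//.
    by rewrite normrM mulr_ile1 ?cos_max ?cutoff_le1.
  apply: (le_trans (ler_normD _ _)); rewrite !normrM lerD//.
    by rewrite -[leRHS]mul1r ler_pM ?cos_max.
  by rewrite -[leRHS]mul1r ler_pM ?cos_max.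
move=> -[x y] xy; rewrite /kernel/=.
have [xI|xI] := pselect (cos_box n a x); last by rewrite cutoff0// mulr0 mul0r.
have yB : ~ box y by move=> yB; apply: xy.
by rewrite p0// q0// !mulr0 addr0 mulr0.
Qed.

Let integrable_pq (x : n.-tuple mR) : mu.-integrable setT
  (EFin \o (fun t => cos (phase n (tnth x) t) * p t
     + cos (phase n (tnth x) t - pi / 2) * q t)).
Proof.
apply: (@integrable_bounded_support _ _ R mu box _ (M + M)).
- exact: mbox.
- exact: lebesgue_tuple_box_lty.
- apply: measurable_funD; apply: measurable_funM => //; apply: measurable_cosT.
    exact: measurable_phase.
  by apply: measurable_funB => //; exact: measurable_phase.
- move=> z _; apply: (le_trans (ler_normD _ _)); rewrite !normrM lerD//.
    by rewrite -[leRHS]mul1r ler_pM ?cos_max.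
  by rewrite -[leRHS]mul1r ler_pM ?cos_max.
- by move=> y yB; rewrite p0// q0// !mulr0 addr0.
Qed.

Let fubini_kernel a x : fubini_F mu (EFin \o kernel a) x =
  (cos (phase n t0 x) * trig_transform n p q x * cutoff n N a x)%:E.
Proof.
rewrite /fubini_F/=.
have -> : (\int[mu]_y (kernel a (x, y))%:E)%E =
    (\int[mu]_t (cos (phase n t0 x) * cutoff n N a x *
     (cos (phase n (tnth x) t) * p t + cos (phase n (tnth x) t - pi / 2) * q t)))%:E.
  rewrite /Rintegral fineK//; apply: integrable_fin_num => //.
  by apply: integrable_mulrl => //; exact: integrable_pq.
rewrite RintegralZl//.
by rewrite -/(trig_transform n p q x) mulrAC.
Qed.

(** [trig_transform] is a parametric integral; its measurability in [x] comes from that of the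
    partial integrals of [kernel]. *)
Lemma measurable_pairing a : measurable_fun [set: n.-tuple mR]
  (fun x => cos (phase n t0 x) * trig_transform n p q x * cutoff n N a x).
Proof.
apply/measurable_EFinP.
have := measurable_fubini_F (integrable_kernel a).
by rewrite (funext (fubini_kernel a)).
Qed.

(** What integrating [kernel] over space leaves. Product-to-sum formulas produce the frequencies
    [t0 + t] and [t0 - t]; since [2 * cos A * sin B = sin (A + B) - sin (A - B)], the [q] terms get
    the phases [- (pi / 2)] and [pi / 2], the latter encoding the minus sign. *)
Let pairing_kernel a (t : n.-tuple mR) : R :=
  let sp i := t0 i + tnth t i in let sm i := t0 i - tnth t i in
  2^-1 * p t * cutoff_cos_integral n N a sp 0 +
  2^-1 * p t * cutoff_cos_integral n N a sm 0 +
  (2^-1 * q t * cutoff_cos_integral n N a sp (- (pi / 2)) +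
   2^-1 * q t * cutoff_cos_integral n N a sm (pi / 2)).

Let fubini_kernel2 a t : fubini_G mu (EFin \o kernel a) t = (pairing_kernel a t)%:E.
Proof.
pose sp i := t0 i + tnth t i; pose sm i := t0 i - tnth t i.
rewrite /fubini_G/=.
pose f s th (x : n.-tuple mR) := cos (phase n s x + th) * cutoff n N a x.
have If c s th : mu.-integrable setT (EFin \o (fun x => c * f s th x)).
  by apply: integrable_mulrl => //; exact: integrable_cos_cutoff.
have kE x : kernel a (x, t) =
    2^-1 * p t * f sp 0 x + 2^-1 * p t * f sm 0 x +
    (2^-1 * q t * f sp (- (pi / 2)) x + 2^-1 * q t * f sm (pi / 2) x).
  have spE : phase n sp x = phase n t0 x + phase n (tnth x) t.
    rewrite /phase -big_split/=; apply: eq_bigr => i _.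
    by rewrite mulrDl [tnth t i * _]mulrC.
  have smE : phase n sm x = phase n t0 x - phase n (tnth x) t.
    rewrite /phase -sumrN -big_split/=; apply: eq_bigr => i _.
    by rewrite mulrBl [tnth t i * _]mulrC.
  rewrite /kernel /f spE smE !addr0 cosBpihalf cosBpihalf cosDpihalf/=.
  rewrite sinD sinB cosD cosB.
  by field.
have I2 (f1 f2 : n.-tuple mR -> R) :
    mu.-integrable setT (EFin \o f1) -> mu.-integrable setT (EFin \o f2) ->
    mu.-integrable setT (EFin \o (fun x => f1 x + f2 x)).
  by move=> i1 i2; exact: (integrableD measurableT i1 i2).
transitivity (\int[mu]_x (kernel a (x, t)))%:E.
  rewrite /Rintegral fineK//; apply: integrable_fin_num => //.
  have h := I2 _ _ (I2 _ _ (If (2^-1 * p t) sp 0) (If (2^-1 * p t) sm 0))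
    (I2 _ _ (If (2^-1 * q t) sp (- (pi / 2))) (If (2^-1 * q t) sm (pi / 2))).
  by rewrite -(funext kE) in h.
under eq_Rintegral do rewrite kE.
rewrite RintegralD//; [|by apply: I2; exact: If|by apply: I2; exact: If].
rewrite !RintegralD//; try exact: If.
rewrite !RintegralZl//; try exact: integrable_cos_cutoff.
Qed.

(** After exchanging the integrals, [p] and [q] each meet two transforms of the cutoff with weight
    [2^-1], so the bound is [e] times the integral of [|p| + |q|]. Only frequencies where [p] or [q]
    is nonzero contribute. *)
Lemma pairing_le a e :
  (forall (t : n.-tuple mR) th, p t != 0 \/ q t != 0 ->
    `|cutoff_cos_integral n N a (fun i => t0 i + tnth t i) th| <= e /\
    `|cutoff_cos_integral n N a (fun i => t0 i - tnth t i) th| <= e) ->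
  `|\int[mu]_x (cos (phase n t0 x) * trig_transform n p q x * cutoff n N a x)| <=
  e * \int[mu]_t (`|p t| + `|q t|).
Proof.
move=> he.
have -> : \int[mu]_x (cos (phase n t0 x) * trig_transform n p q x * cutoff n N a x) =
    \int[mu]_t pairing_kernel a t.
  rewrite /Rintegral; congr fine.
  under eq_integral do rewrite -fubini_kernel.
  rewrite (integral12_prod_meas1 (integrable_kernel a)).
  rewrite -(integral21_prod_meas1 (integrable_kernel a)).
  by apply: eq_integral => t _; rewrite fubini_kernel2.
have Ipq : mu.-integrable setT (EFin \o (fun t => `|p t| + `|q t|)).
  apply: (@integrable_bounded_support _ _ R mu box _ (M + M)).
  - exact: mbox.
  - exact: lebesgue_tuple_box_lty.
  - by apply: measurable_funD; apply: measurableT_comp.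
  - by move=> t _; rewrite ger0_norm ?addr_ge0// lerD.
  - by move=> t tB; rewrite p0// q0// normr0 addr0.
have kb t : `|pairing_kernel a t| <= e * (`|p t| + `|q t|).
  have [pq|pq] := pselect (p t != 0 \/ q t != 0); last first.
    have /eqP pt : p t == 0 by apply: contrapT => h; apply: pq; left; apply/negP.
    have /eqP qt : q t == 0 by apply: contrapT => h; apply: pq; right; apply/negP.
    by rewrite /pairing_kernel pt qt !mulr0 !mul0r !addr0 normr0 addr0 mulr0.
  have [hp0 hm0] := he t 0 pq.
  have [hpl _] := he t (- (pi / 2)) pq.
  have [_ hmr] := he t (pi / 2) pq.
  have b c C : `|C| <= e -> `|2^-1 * c * C| <= 2^-1 * (e * `|c|).
    move=> Ce; rewrite !normrM ger0_norm ?invr_ge0// -mulrA ler_wpM2l ?invr_ge0//.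
    by rewrite mulrC ler_wpM2r.
  apply: (le_trans (ler_normD _ _)); rewrite mulrDr; apply: lerD.
    apply: (le_trans (ler_normD _ _)); rewrite [leRHS]splitr [e * _ / 2]mulrC.
    by apply: lerD; apply: b.
  apply: (le_trans (ler_normD _ _)); rewrite [leRHS]splitr [e * _ / 2]mulrC.
  by apply: lerD; apply: b.
have Ik : mu.-integrable setT (EFin \o pairing_kernel a).
  have Iepq := integrable_mulrl _ _ _ mu _ _ e measurableT Ipq.
  apply: (le_integrable measurableT _ _ Iepq).
    have := measurable_fubini_G (integrable_kernel a).
    by rewrite (funext (fubini_kernel2 a)).
  by move=> t _; rewrite /= lee_fin (le_trans (kb t))// ler_norm.
apply: (le_trans (le_normr_Rintegral measurableT Ik)).
rewrite -RintegralZl//; apply: le_Rintegral => //.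
- exact: (integrable_norm Ik).
- exact: integrable_mulrl.
Qed.
End pairing.

(** Coordinate [i] contributes the decay bound with [M = n], every other one only [pi / a]. The
    product is [(2 * pi / a) ^+ n * (c * a ^+ 2) ^+ n], of order [a ^+ n]. *)
Lemma cutoff_cos_integral_decay n (s : 'I_n -> R) a th d : 0 < a -> 0 < d ->
  2 * a * n.*2%:R <= d -> (exists i, d <= `|s i|) ->
  `|cutoff_cos_integral n n.*2 a s th| <=
    (2 * pi * (2 * n.*2%:R ^+ 2 / d ^+ 2) * a) ^+ n.
Proof.
move=> a0 d0 ad [i ds].
set c := 2 * n.*2%:R ^+ 2 / d ^+ 2.
pose b j : R := (if j == i then (c * a ^+ 2) ^+ n else 1) * (pi / a).
have sb j t : `|cos_power_integral n.*2 a (s j) t| <= b j.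
  rewrite /b; case: eqP => [->|_]; first exact: cos_power_integral_decay ds.
  by rewrite mul1r cos_power_integral_bound.
apply: (le_trans (cutoff_cos_integral_le _ _ _ _ _ _ sb)).
rewrite /b (eq_bigr (fun j => (2 * (pi / a)) *
  (if j == i then (c * a ^+ 2) ^+ n else 1))); last by move=> j _; ring.
rewrite big_split/= prodr_const card_ord -big_mkcond/= big_pred1_eq -exprMn.
rewrite (_ : 2 * (pi / a) * (c * a ^+ 2) = 2 * pi * c * a)//.
by field; rewrite gt_eqF.
Qed.

(** Where [p] or [q] is nonzero, both [t0 + t] and [t0 - t] stay away from 0, so the truncations
    with [a = harmonic k] are [O(a ^+ n)] and tend to 0. *)
Lemma pairing_eq0 n (t0 : 'I_n -> R) (p q : n.-tuple mR -> R) (M d : R)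
    (l u : 'I_n -> R) :
  (0 < n)%N -> 0 < d ->
  measurable_fun [set: n.-tuple mR] p -> measurable_fun [set: n.-tuple mR] q ->
  (forall t, `|p t| <= M) -> (forall t, `|q t| <= M) ->
  (forall t, p t != 0 \/ q t != 0 -> [/\ forall i, `[l i, u i]%classic (tnth t i),
    exists i, d <= `|t0 i + tnth t i| & exists i, d <= `|t0 i - tnth t i|]) ->
  \int[lebesgue_tuple n]_x (cos (phase n t0 x) * trig_transform n p q x) = 0.
Proof.
move=> n0 d0 mp mq pM qM pq.
have p0 t : ~ (forall i, `[l i, u i]%classic (tnth t i)) -> p t = 0.
  move=> tB; apply: contrapT => /eqP pt; apply: tB.
  by have [] := pq t (or_introl pt).
have q0 t : ~ (forall i, `[l i, u i]%classic (tnth t i)) -> q t = 0.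
  move=> tB; apply: contrapT => /eqP pt; apply: tB.
  by have [] := pq t (or_intror pt).
apply: (@Rintegral_eq0_truncation n n.*2) => [k|].
  exact: (@measurable_pairing _ _ _ _ _ M l u).
set c := 2 * pi * (2 * n.*2%:R ^+ 2 / d ^+ 2).
pose P := \int[lebesgue_tuple n]_t (`|p t| + `|q t|).
pose b k := (c * harmonic k) ^+ n * P.
have h0 k : 0 < harmonic k :> R by rewrite /harmonic/= invr_gt0.
have cvg0 (e : R) : e * harmonic k @[k --> \oo] --> (0 : R).
  have -> : nbhs (0 : R) = nbhs (e * 0 : R) by rewrite mulr0.
  by apply: cvgM; [exact: cvg_cst|exact: cvg_harmonic].
have b0 : b k @[k --> \oo] --> (0 : R).
  (* Here [0 < n] is essential: [0 ^+ 0] is 1. *)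
  have -> : nbhs (0 : R) = nbhs (0 ^+ n * P) by rewrite expr0n -[_ == _]negbK -lt0n n0 mul0r.
  apply: cvgM; last exact: cvg_cst.
  apply: (@cvg_comp _ _ _ (fun k => c * harmonic k) (fun y => y ^+ n)); first exact: cvg0.
  exact: exprn_continuous.
have small : \forall k \near \oo, 2 * harmonic k * n.*2%:R <= d.
  have /cvgr0_norm_le/(_ d d0) := cvg0 (2 * n.*2%:R).
  by apply: filterS => k; move/(le_trans (ler_norm _)); rewrite mulrAC.
have bnd : \forall k \near \oo, - b k <=
    \int[lebesgue_tuple n]_x (cos (phase n t0 x) * trig_transform n p q x *
      cutoff n n.*2 (harmonic k) x) <= b k.
  apply: filterS small => k ak; rewrite -ler_norml.
  apply: (@pairing_le _ _ _ _ _ M l u) => // t th /pq[_ tp tm].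
  by split; apply: cutoff_cos_integral_decay.
apply: (squeeze_cvgr bnd); last exact: b0.
by rewrite -oppr0; exact: cvgN.
Qed.
End truncation.

(** * Measurability of the passage from tuples to row vectors *)

Section row_vectors.
Context {R : realType} {n : nat}.
Local Notation mR := (measurableTypeR R).
Local Notation Rn := 'rV[R]_n.

(** Rational boxes form a countable base, which makes preimages of open sets measurable for the
    product sigma-algebra. *)
Lemma open_bigcup_rat_box (U : set Rn) : open U ->
  U = \bigcup_(z in [set z : 'rV[rat]_n * nat |
        [set v : Rn | forall i, `|v ord0 i - ratr (z.1 ord0 i)| < z.2.+1%:R^-1] `<=` U])
      [set v : Rn | forall i, `|v ord0 i - ratr (z.1 ord0 i)| < z.2.+1%:R^-1].
Proof.
move=> oU; apply/seteqP; split => [v Uv|v [z /= zU vz]]; last exact: zU.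
have /nbhs_ballP[e /= e0 eU] : nbhs v U by exact: open_nbhs_nbhs.
(* Half of [e], because [v] and another point of the box are compared through its rational
   centre. *)
have [k ke] : exists k : nat, k.+1%:R^-1 < e / 2.
  have := near_infty_natSinv_lt (PosNum (divr_gt0 e0 (ltr0Sn R 1))).
  by move=> [k _ /(_ k (leqnn k))]; exists k.
have k0 : 0 < k.+1%:R^-1 :> R by rewrite invr_gt0.
have qP i : exists q : rat, `|v ord0 i - ratr q| < k.+1%:R^-1.
  have /rat_in_itvoo[q] : v ord0 i - k.+1%:R^-1 < v ord0 i + k.+1%:R^-1.
    by rewrite ltrD2l gtrN.
  rewrite in_itv/= => /andP[a b]; exists q.
  by rewrite ltr_norml; apply/andP; split; move: a b; move: (_^-1) => K; lra.
pose q := \row_i sval (cid (qP i)).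
have qE i : `|v ord0 i - ratr (q ord0 i)| < k.+1%:R^-1.
  by rewrite mxE; exact: svalP (cid (qP i)).
exists (q, k) => //= w wq; apply: eU; split => // i j; rewrite (ord1 i).
rewrite /ball/= /ball_/=.
apply: (le_lt_trans (ler_distD (ratr (q ord0 j)) _ _)).
rewrite [e]splitr ltrD// (lt_trans _ ke)// distrC; exact: wq.
Qed.

Lemma measurable_row_of_tuple (U : set Rn) : open U ->
  measurable (row_of_tuple @^-1` U : set (n.-tuple mR)).
Proof.
move=> oU; rewrite (open_bigcup_rat_box _ oU) preimage_bigcup bigcup_mkcond.
apply: countable_bigcupT_measurable; first exact: countableP.
move=> z; case: ifP => // _.
rewrite (_ : _ @^-1` _ = [set t : n.-tuple mR | forall i,
  `]ratr (z.1 ord0 i) - z.2.+1%:R^-1, ratr (z.1 ord0 i) + z.2.+1%:R^-1[%classic (tnth t i)]).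
  apply: (@measurable_box R n (fun i => `]ratr (z.1 ord0 i) - z.2.+1%:R^-1,
     ratr (z.1 ord0 i) + z.2.+1%:R^-1[%classic : set mR)) => i.
  exact: measurable_itv.
apply/seteqP; split => t /= h i; have := h i; rewrite !mxE in_itv/= ltr_distl//.
Qed.

Lemma measurable_continuous_row (g : Rn -> R) : continuous g ->
  measurable_fun [set: n.-tuple mR] (g \o row_of_tuple).
Proof.
move=> cg; apply: (measurability _ (RGenOpens.measurableE R)) => _ [_ [a [b ->] <-]].
rewrite setTI comp_preimage.
apply: measurable_row_of_tuple.
by move/continuousP : cg; apply; exact: interval_open.
Qed.

End row_vectors.

(** * The spectrum of a cosine wave *)

Section spectrum.
Context {R : realType} {n : nat}.
Local Notation mR := (measurableTypeR R).
Local Notation Rn := 'rV[R]_n.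
Local Notation row_of := (@row_of_tuple R n).

Lemma dot_row_of_tuple (v : Rn) (x : n.-tuple mR) :
  dot v (row_of x) = phase n (v ord0) x.
Proof. by rewrite /dot /phase; apply: eq_bigr => i _; rewrite mxE. Qed.

Lemma euclidean_ball_coord (c x : Rn) r i : 0 < r -> euclidean_ball c r x ->
  `|x ord0 i - c ord0 i| < r.
Proof.
move=> r0; rewrite /euclidean_ball/= => xr.
apply: le_lt_trans xr; rewrite -sqrtr_sqr ler_wsqrtr//.
rewrite /dot (bigD1 i)//= !mxE -expr2 lerDl.
by apply: sumr_ge0 => j _; rewrite -expr2 sqr_ge0.
Qed.

(** Neighbourhoods of a row vector are given by the sup norm, so distance from [A] shows in a single
    coordinate, which may depend on the point. This is the form that the coordinatewise decay
    estimate takes. *)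
Lemma notin_closure_coord (A : set Rn) (v : Rn) : ~ closure A v ->
  exists2 d : R, 0 < d & forall y, A y -> exists i, d <= `|v ord0 i - y ord0 i|.
Proof.
move=> vA.
have /existsNP[B /not_implyP[nB /set0P/negP/negPn/eqP AB]] : ~ forall B, nbhs v B -> A `&` B !=set0.
  exact: vA.
move/nbhs_ballP : nB => [d /= d0 dB]; exists d => // y Ay.
apply: contrapT => /forallNP yd.
have : (A `&` B) y.
  split => //; apply: dB; split => // i j; rewrite (ord1 i) /ball/= /ball_/=.
  by rewrite ltNge; apply/negP; exact: yd.
by rewrite AB.
Qed.

Lemma compact_row_box (l u : 'I_n -> R) :
  compact [set v : Rn | forall i, `[l i, u i]%classic (v ord0 i)].
Proof.
apply: (@rV_compact _ _ (fun i => `[l i, u i]%classic)) => i.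
exact: segment_compact.
Qed.

Lemma continuous_box_bounded (g : Rn -> R) (l u : 'I_n -> R) : continuous g ->
  (forall v : Rn, ~ (forall i, `[l i, u i]%classic (v ord0 i)) -> g v = 0) ->
  exists M, forall v, `|g v| <= M.
Proof.
move=> cg g0.
have := compact_bounded (continuous_compact (continuous_subspaceT cg) (compact_row_box l u)).
move=> [M [_ hM]]; exists (`|M| + 1) => v.
have [vB|vB] := pselect (forall i, `[l i, u i]%classic (v ord0 i)); last first.
  by rewrite g0// normr0 addr_ge0.
by apply: (hM (`|M| + 1)); [rewrite ltr_pwDr// ler_norm|exists v].
Qed.

(** Expanding [(cos y - i sin y) * (p + i q)] gives real part [cos y * p + sin y * q] and imaginary
    part [cos y * q - sin y * p], whence the pair [q], [- p] in [Im_fourier]. *)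
Lemma Re_fourier (phi : Rn -> R[i]) (x : n.-tuple mR) :
  complex.Re (fourier phi (row_of x)) =
  trig_transform n (@complex.Re R \o phi \o row_of) (@complex.Im R \o phi \o row_of) x.
Proof.
rewrite /fourier /cintegral /trig_transform/=; apply: eq_Rintegral => t _ /=.
rewrite dot_row_of_tuple cosBpihalf.
have -> : phase n (row_of t ord0) x = phase n (tnth x) t.
  by rewrite /phase; apply: eq_bigr => i _; rewrite mxE mulrC.
by case: (phi _) => a b /=; ring.
Qed.

Lemma Im_fourier (phi : Rn -> R[i]) (x : n.-tuple mR) :
  complex.Im (fourier phi (row_of x)) =
  trig_transform n (@complex.Im R \o phi \o row_of) (-%R \o @complex.Re R \o phi \o row_of) x.
Proof.
rewrite /fourier /cintegral /trig_transform/=; apply: eq_Rintegral => t _ /=.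
rewrite dot_row_of_tuple cosBpihalf.
have -> : phase n (row_of t ord0) x = phase n (tnth x) t.
  by rewrite /phase; apply: eq_bigr => i _; rewrite mxE mulrC.
by case: (phi _) => a b /=; ring.
Qed.

(** The wave has the two frequencies [t0] and [- t0]. Both lie in [K], hence outside the closed
    support of [phi] and at a positive distance from it. *)
Lemma spectrum_in_cos (K : set Rn) (t0 : Rn) : (0 < n)%N -> K t0 -> K (- t0) ->
  spectrum_in K (fun x => (cos (dot t0 x))%:C%C).
Proof.
move=> n0 Kt0 KNt0 phi [sRe sIm] [c [r [r0 phir rK]]].
have [cRe _] := sRe [::]; have [cIm _] := sIm [::].
have out v : K v -> ~ supp phi v.
  by move=> Kv /phir vr; have : (euclidean_ball c r `&` K) v by []; rewrite rK.
have [d1 d10 hd1] := notin_closure_coord _ _ (out _ Kt0).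
have [d2 d20 hd2] := notin_closure_coord _ _ (out _ KNt0).
pose l i := c ord0 i - r; pose u i := c ord0 i + r.
have phi_box (v : Rn) : phi v != 0 -> forall i, `[l i, u i]%classic (v ord0 i).
  move=> /(@subset_closure _ [set t | phi t != 0] v)/phir h i.
  have := euclidean_ball_coord _ _ _ i r0 h.
  rewrite ltr_distl => /andP[h1 h2].
  by rewrite /= in_itv/= /l /u (ltW h1) (ltW h2).
pose P := @complex.Re R \o phi \o row_of; pose Q := @complex.Im R \o phi \o row_of.
have mP : measurable_fun [set: n.-tuple mR] P by exact: measurable_continuous_row.
have mQ : measurable_fun [set: n.-tuple mR] Q by exact: measurable_continuous_row.
have phi0 (v : Rn) : ~ (forall i, `[l i, u i]%classic (v ord0 i)) -> phi v = 0.
  by move=> vB; apply: contrapT => /eqP/phi_box.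
have [M1 hM1] : exists M, forall v, `|complex.Re (phi v)| <= M.
  by apply: (continuous_box_bounded _ l u) => // v /phi0 ->.
have [M2 hM2] : exists M, forall v, `|complex.Im (phi v)| <= M.
  by apply: (continuous_box_bounded _ l u) => // v /phi0 ->.
pose M := Num.max M1 M2; pose d := Num.min d1 d2.
have main (p q : n.-tuple mR -> R) : measurable_fun [set: n.-tuple mR] p ->
    measurable_fun [set: n.-tuple mR] q ->
    (forall t, `|p t| <= M) -> (forall t, `|q t| <= M) ->
    (forall t, p t != 0 \/ q t != 0 -> phi (row_of t) != 0) ->
    \int[lebesgue_tuple n]_x (cos (phase n (t0 ord0) x) * trig_transform n p q x) = 0.
  move=> mp mq pM qM pq.
  apply: (@pairing_eq0 _ _ _ _ _ M d l u) => //; first by rewrite lt_min d10.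
  move=> t /pq pt; split.
  - by move=> i; have := phi_box _ pt i; rewrite mxE.
  (* Distance of the support from [- t0] bounds the sum [t0 + t]; distance from [t0] bounds the
     difference. *)
  - have [i hi] := hd2 _ pt; exists i; rewrite ge_min; apply/orP; right.
    by move: hi; rewrite !mxE -opprD normrN.
  - have [i hi] := hd1 _ pt; exists i; rewrite ge_min; apply/orP; left.
    by move: hi; rewrite !mxE.
have Re0 z : complex.Re z != 0 -> z != 0 :> R[i] by apply: contraNN => /eqP ->.
have Im0 z : complex.Im z != 0 -> z != 0 :> R[i] by apply: contraNN => /eqP ->.
have M1M t : `|P t| <= M by rewrite le_max hM1.
have M2M t : `|Q t| <= M by rewrite le_max hM2 orbT.
have ReM (a : R) (z : R[i]) : complex.Re (a%:C%C * z) = a * complex.Re z.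
  by case: z => x y /=; ring.
have ImM (a : R) (z : R[i]) : complex.Im (a%:C%C * z) = a * complex.Im z.
  by case: z => x y /=; ring.
rewrite /cintegral.
under eq_Rintegral do rewrite ReM Re_fourier dot_row_of_tuple.
under [X in (_ +i* X)%C]eq_Rintegral do rewrite ImM Im_fourier dot_row_of_tuple.
have -> := main P Q mP mQ M1M M2M; last by move=> t [/Re0|/Im0].
have -> // := main Q (-%R \o P) mQ _ M2M.
- exact: measurableT_comp.
- by move=> t; rewrite /= normrN M1M.
- by move=> t [/Im0//|]; rewrite /= oppr_eq0 => /Re0.
Qed.
End spectrum.

(** * Zero sets of cosine waves: covering without sampling *)

Section cosine_waves.
Context {R : realType} {n : nat}.
Local Notation Rn := 'rV[R]_n.

Lemma continuous_dot (T : topologicalType) (f g : T -> Rn) :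
  continuous f -> continuous g -> continuous (fun z => dot (f z) (g z)).
Proof.
move=> cf cg; apply: continuous_big => [|i _]; first exact: add_continuous.
have coord (h : T -> Rn) : continuous h -> continuous (fun z => h z ord0 i).
  move=> ch z.
  have cv : {for h z, continuous (fun v : Rn => v ord0 i)} by exact: coord_continuous.
  exact: (continuous_comp (ch z) cv).
by move=> z; apply: continuousM; exact: coord.
Qed.

Lemma dotC (x y : Rn) : dot x y = dot y x.
Proof. by apply: eq_bigr => i _; rewrite mulrC. Qed.

Lemma dotZr (t x : Rn) a : dot t (a *: x) = a * dot t x.
Proof. by rewrite /dot mulr_sumr; apply: eq_bigr => i _; rewrite mxE; ring. Qed.

Lemma dotBr (t x y : Rn) : dot t (x - y) = dot t x - dot t y.
Proof. by rewrite /dot -sumrB; apply: eq_bigr => i _; rewrite !mxE; ring. Qed.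

Lemma continuous_real_complex (g : Rn -> R) : continuous g ->
  continuous ((fun x => (g x)%:C%C) : Rn -> R[i]^o).
Proof.
move=> cg x; apply: (@cvgrPdist_lt _ _ _ (nbhs x) (nbhs_filter x) _ _).2 => -[e e'].
(* A positive complex number is real, so the radius has zero imaginary part. *)
rewrite ltcE/= => /andP[/eqP -> e0].
have := (@cvgrPdist_lt _ _ _ (nbhs x) (nbhs_filter x) g (g x)).1 (cg x) e e0.
apply: filterS => y xy.
by rewrite -rmorphB/= normc_def/= expr0n addr0 sqrtr_sqr ltcR.
Qed.

Lemma normc_real (x : R) : Normc.normc (x%:C%C) = `|x|.
Proof. by rewrite /Normc.normc/= expr0n addr0 sqrtr_sqr. Qed.

Lemma bernstein_space_cos (K : set Rn) (t : Rn) : (0 < n)%N -> K t -> K (- t) ->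
  bernstein_space K (fun x => (cos (dot t x))%:C%C).
Proof.
move=> n0 Kt KNt; split; last exact: spectrum_in_cos.
  apply: continuous_real_complex => x.
  apply: (@cvg_comp _ _ _ (dot t) cos); last exact: continuous_cos.
  have cid : continuous (id : Rn -> Rn) by move=> y; exact: cvg_id.
  exact: (continuous_dot _ (fun=> t) id (@cst_continuous _ _ t) cid).
by exists 1 => x; rewrite normc_real cos_max.
Qed.

(** The wave equals 1 at the origin and vanishes on the set, so a sampling inequality would read
    [1 <= C * 0]. *)
Lemma zero_set_cos_not_sampling (K : set Rn) (t : Rn) : (0 < n)%N -> K t -> K (- t) ->
  ~ sampling_set [set x | cos (dot t x) = 0] K.
Proof.
move=> n0 Kt KNt [C C0] /(_ _ (bernstein_space_cos _ _ n0 Kt KNt)).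
set L := [set x | _]; set E := (X in sup X <= _); set F := (X in _ <= C * sup X).
have E1 : 1 <= sup E.
  apply: ub_le_sup; last first.
    have dot0 : dot t 0 = 0 by rewrite /dot big1// => i _; rewrite mxE mulr0.
    by exists 0 => //; rewrite normc_real dot0 cos0 normr1.
  by exists 1 => _ [x _ <-]; rewrite normc_real cos_max.
have F0 : sup F = 0.
  (* The zero set is empty when [t = 0]; then [sup set0 = 0] gives the same value. *)
  have [L0|/set0P[x Lx]] := eqVneq L set0.
    by rewrite /F L0 image_set0 sup0.
  rewrite -(sup1 0) /F; congr sup; apply/seteqP; split => [_ [y Ly <-]|_ ->].
    by rewrite normc_real Ly normr0 /=.
  by exists x; rewrite ?normc_real ?Lx ?normr0.
by rewrite F0 mulr0 => /(le_trans E1); rewrite ler10.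
Qed.

(** At [y - pi / 2] and [y + pi / 2] the cosine takes the opposite values [sin y] and [- sin y], so
    the intermediate value theorem applies. *)
Lemma cos_zero_near (y : R) : exists2 z, `|y - z| <= pi / 2 & cos z = 0.
Proof.
have ph : 0 <= pi / 2 :> R by rewrite divr_ge0 ?pi_ge0.
have yy : y - pi / 2 <= y + pi / 2 by lra.
have [||z zy cz] := @IVT R cos _ _ 0 yy.
- by apply: continuous_subspaceT; exact: continuous_cos.
- rewrite cosBpihalf cosDpihalf ge_min le_max oppr_le0 oppr_ge0.
  by case: (leP 0 (sin y)) => h; rewrite ?h ?orbT //= (ltW h).
exists z => //; rewrite ler_distlC; move: zy; rewrite in_itv/=.
by [].
Qed.

(** [c *: s] is the convex combination of [s] and [- s] with weight [(1 + c) / 2] on [s]. *)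
Lemma symmetric_convex_scale (S : set Rn) (s : Rn) (c : R) :
  symmetric_convex_body S -> S s -> -1 <= c <= 1 -> S (c *: s).
Proof.
move=> [_ Sconv _ Ssym] Ss /andP[c1 c2].
have SNs : S (- s) by rewrite Ssym; exists s.
have k0 : 0 <= (1 + c) / 2 by lra.
have k1 : (1 + c) / 2 <= 1 by lra.
have h := Sconv s (- s) (Itv01 k0 k1) (mem_set Ss) (mem_set SNs).
have -> : c *: s = ((1 + c) / 2) *: s + (1 - (1 + c) / 2) *: - s.
  by rewrite scalerN -scalerBl; congr (_ *: s); field.
exact: set_mem h.
Qed.

(** Moving [x] by [c *: s] with [|c| <= 1] changes [dot t x] by up to [dot t s >= pi / 2] either
    way, enough to reach a zero of the cosine. *)
Lemma zero_set_cos_add (S : set Rn) (s t : Rn) :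
  symmetric_convex_body S -> S s -> pi / 2 <= dot t s ->
  [set a + b | a in [set x | cos (dot t x) = 0] & b in S] = [set: Rn].
Proof.
move=> hS Ss ts; apply/seteqP; split => // x _.
have [z yz cz] := cos_zero_near (dot t x).
have m0 : 0 < dot t s by rewrite (lt_le_trans _ ts)// divr_gt0 ?pi_gt0.
pose c := (dot t x - z) / dot t s.
have cm : c * dot t s = dot t x - z by rewrite divfK ?gt_eqF.
have c1 : -1 <= c <= 1.
  by rewrite -ler_norml normrM normfV (gtr0_norm m0) ler_pdivrMr// mul1r (le_trans yz).
exists (x - c *: s); first by rewrite /= dotBr dotZr cm subKr.
by exists (c *: s); [exact: symmetric_convex_scale|rewrite subrK].
Qed.

(** Attainment of the maximum is what makes the final inequality [rho < pi / 2] strict. *)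
Lemma dot_compact_max (S K : set Rn) : compact S -> compact K -> S !=set0 -> K !=set0 ->
  exists s t, [/\ S s, K t & forall s' t', S s' -> K t' -> dot s' t' <= dot s t].
Proof.
move=> cS cK [s0 Ss0] [t0 Kt0].
have cdot : continuous (fun z : Rn * Rn => dot z.1 z.2).
  by apply: (continuous_dot _ fst snd) => z; [exact: cvg_fst|exact: cvg_snd].
have [[s t]] := @compact_EVT_max _ _ (fun z : Rn * Rn => dot z.1 z.2) (S `*` K)
  (ex_intro _ (s0, t0) (conj Ss0 Kt0)) (compact_setX cS cK) (continuous_subspaceT cdot).
rewrite inE => -[/= Ss Kt] stmax; exists s, t; split => // s' t' Ss' Kt'.
by apply: (stmax (s', t')); rewrite inE.
Qed.
End cosine_waves.

Theorem corollary1 (R : realType) (n : nat) (hn : (1 <= n)%N)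
    (K S : set 'rV[R]_n)
    (hK : symmetric_convex_body K) (hKvol : (0 < volume K)%E)
    (hS : symmetric_convex_body S)
    (hsampling : forall L : set 'rV[R]_n,
       [set a + b | a in L & b in S] = [set: 'rV[R]_n] -> sampling_set L K) :
  exists rho : R, [/\ 0 <= rho, rho < pi / 2 &
    S `<=` [set rho *: x | x in polar K]].
Proof.
have [cK _ [k0 /interior_subset Kk0] symK] := hK.
have [cS _ [s0 /interior_subset Ss0] _] := hS.
have [s [t [Ss Kt stmax]]] := dot_compact_max _ _ cS cK
  (ex_intro _ s0 Ss0) (ex_intro _ k0 Kk0).
have st : dot s t < pi / 2.
  rewrite ltNge; apply/negP => st.
  have KNt : K (- t) by rewrite symK; exists t.
  apply: (zero_set_cos_not_sampling _ _ hn Kt KNt); apply: hsampling.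
  by apply: zero_set_cos_add Ss _ => //; rewrite dotC.
have p4 : 0 < pi / 4 :> R by rewrite divr_gt0 ?pi_gt0.
(* The maximum with [pi / 4] makes [rho] invertible without a separate proof that [dot s t] is
   positive; any constant strictly between 0 and [pi / 2] would serve. *)
pose rho := Num.max (pi / 4) (dot s t).
have rho0 : 0 < rho by rewrite lt_max p4.
exists rho; split; first exact: ltW.
  by rewrite gt_max st andbT; lra.
move=> x Sx; exists (rho^-1 *: x); last by rewrite scalerA divff ?scale1r ?gt_eqF.
move=> k Kk; rewrite dotC dotZr dotC mulrC ler_pdivrMr// mul1r.
by rewrite le_max stmax ?orbT.
Qed.
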